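(* Let $\mathcal{K}=(\Sigma,\to,\ell)$ be a Kripke structure and let $\mathcal{P}=\langle P,\trianglelefteq\rangle$ be a preorder PR on $\Sigma$ (i.e. $\trianglelefteq$ is reflexive and transitive on $P$). Then the relation $\mathrm{Rel}(\mathcal{P})=\{(s,t)\in\Sigma\times\Sigma \mid P(s)\trianglelefteq P(t)\}$ is a simulation on $\mathcal{K}$ if and only if all of the following hold: (i) for all $B,C\in P$ with $B\trianglelefteq C$, all $b\in B$ and all $c\in C$, we have $\ell(b)=\ell(c)$; (ii) for all $B,C,D\in P$, if $B\to^{\exists} C$ and $B\trianglelefteq D$ then $D\to^{\exists}\mu_{\mathcal{P}}(C)$; (iii) for every $C\in P$, $\mathrm{Split}(P,\mathrm{pre}(\mu_{\mathcal{P}}(C)))=P$, i.e. every block of $P$ is either contained in or disjoint from $\mathrm{pre}(\mu_{\mathcal{P}}(C))$.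
   Context: A Kripke structure $(\Sigma,\to,\ell)$ over a set of atoms $AP$ consists of a set of states $\Sigma$, a transition relation $\to\subseteq\Sigma\times\Sigma$ and a labeling $\ell:\Sigma\to\wp(AP)$. A relation $R\subseteq\Sigma\times\Sigma$ is a simulation if whenever $(s,s')\in R$: $\ell(s)=\ell(s')$, and for every $t$ with $s\to t$ there is $t'$ with $s'\to t'$ and $(t,t')\in R$. A partition-relation pair (PR) $\langle P,\trianglelefteq\rangle$ is a partition $P$ of $\Sigma$ together with a binary relation $\trianglelefteq\subseteq P\times P$; it is a preorder PR if $\trianglelefteq$ is a preorder. $P(s)$ denotes the block of $P$ containing $s$. $\mathrm{pre}(T)=\{s\in\Sigma\mid \exists t\in T.\ s\to t\}$. For $S_1,S_2\subseteq\Sigma$, $S_1\to^{\exists}S_2$ means there exist $s_1\in S_1$, $s_2\in S_2$ with $s_1\to s_2$. For $X\subseteq\Sigma$, $\mu_{\mathcal{P}}(X)=\bigcup\{C\in P\mid \exists s\in X.\ P(s)\trianglelefteq C\}$. For $S\subseteq\Sigma$, $\mathrm{Split}(P,S)$ is the partition obtained by replacing each block $B\in P$ by the nonempty sets among $B\cap S$ and $B\setminus S$. *)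

(* Defs.v *)
From mathcomp Require Import all_boot.
From mathcomp Require Import boolp classical_sets.

Set Implicit Arguments.
Unset Strict Implicit.
Unset Printing Implicit Defensive.

Local Open Scope classical_set_scope.

(* The state space is an arbitrary type: neither finiteness nor totality of the
   transition relation is assumed. *)
Record kripke (AP : Type) := Kripke {
  state : Type;
  trans : state -> state -> Prop;
  label : state -> set AP
}.

Definition simulation (AP : Type) (K : kripke AP)
    (R : state K -> state K -> Prop) : Prop :=
  forall s s', R s s' ->
    label s = label s' /\
    (forall t, trans s t -> exists t', trans s' t' /\ R t t').
Arguments simulation [AP] K R.

Definition pre (AP : Type) (K : kripke AP) (T : set (state K)) :
    set (state K) :=
  [set s | exists t, T t /\ trans s t].

Definition trans_ex (AP : Type) (K : kripke AP) (S1 S2 : set (state K)) :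
    Prop :=
  exists s1 s2, [/\ S1 s1, S2 s2 & trans s1 s2].

(* [pr_rel] has carrier [set S] instead of the subtype of blocks, so [pr_sub]
   makes it a subset of P x P. *)
Record PR (S : Type) := MkPR {
  pr_blocks : set (set S);
  pr_rel : set S -> set S -> Prop;
  pr_part : partition pr_blocks id [set: S];
  pr_sub : forall B C, pr_rel B C -> pr_blocks B /\ pr_blocks C
}.

Definition preorder_PR (S : Type) (P : PR S) : Prop :=
  (forall B, pr_blocks P B -> pr_rel P B B) /\
  (forall B C D, pr_rel P B C -> pr_rel P C D -> pr_rel P B D).

Definition block (S : Type) (P : PR S) (s : S) : set S :=
  pblock (pr_blocks P) id s.

Definition Rel (S : Type) (P : PR S) (s t : S) : Prop :=
  pr_rel P (block P s) (block P t).

Definition mu (S : Type) (P : PR S) (X : set S) : set S :=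
  \bigcup_(C in [set C | pr_blocks P C /\
                         exists s, X s /\ pr_rel P (block P s) C]) C.

Definition split_part (S : Type) (P : set (set S)) (A : set S) : set (set S) :=
  [set X | X !=set0 /\ exists B, P B /\ (X = B `&` A \/ X = B `\` A)].

(* Main.v *)
Require Import Defs.
From mathcomp Require Import all_boot.
From mathcomp Require Import boolp classical_sets.

(** Membership in [mu P C] only depends on blocks: [t] is in [mu P C] iff
    [C] is below the block of [t].  Hence, writing [C] for the block of [t], a
    matching move [s' --> t'] of [s --> t] exists iff [s'] is in
    [pre (mu P C)].  Condition (ii) only says that the block of [s'] meets this
    set, and the stability condition (iii) promotes this to every state of the
    block; conversely stability comes from simulating a block by itself. *)

Set Implicit Arguments.
Unset Strict Implicit.

Local Open Scope classical_set_scope.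

(** [pblock] is a choice with a default value; covering supplies a block around [s], so the default
    is never taken. *)
Lemma block_mem (S : Type) (P : PR S) (s : S) :
  pr_blocks P (block P s) /\ block P s s.
Proof.
have [cov _ _] := pr_part P.
have : cover (pr_blocks P) id s by rewrite cov.
case=> B PB Bs; rewrite /block /pblock /pblock_index.
exact: (getPex (P := [set C | pr_blocks P C /\ C s]) (ex_intro _ B (conj PB Bs))).
Qed.

Lemma block_eq (S : Type) (P : PR S) (B : set S) (s : S) :
  pr_blocks P B -> B s -> block P s = B.
Proof.
move=> PB Bs; have [_ triv _] := pr_part P; have [PX Xs] := block_mem P s.
by apply: triv => //; exists s.
Qed.

Lemma mu_blockE (S : Type) (P : PR S) (C : set S) (t : S) :
  pr_blocks P C -> mu P C t <-> pr_rel P C (block P t).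
Proof.
move=> PC; split=> [[E [PE [s [Cs sE]]] Et]|CE].
  by rewrite (block_eq PE Et) -(block_eq PC Cs).
(* [mu] quantifies over points of [C], so the converse needs one: blocks are nonempty. *)
have [PE Et] := block_mem P t; have [_ _ /(_ C PC) [s Cs]] := pr_part P.
by exists (block P t) => //; split=> //; exists s; rewrite (block_eq PC Cs).
Qed.

Lemma split_part_id (S : Type) (P : PR S) (A : set S) :
  split_part (pr_blocks P) A = pr_blocks P <->
  (forall B, pr_blocks P B -> B `&` A !=set0 -> B `<=` A).
Proof.
have [_ triv ne0] := pr_part P; split=> [eqP B PB BA|stable].
  have PBA : pr_blocks P (B `&` A).
    by rewrite -eqP; split=> //; exists B; split=> //; left.
  case: (BA) => x [Bx Ax].
  (* The piece of [B] inside [A] is itself a block and meets [B], so disjointness of distinct blocks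
     forces equality. *)
  have -> : B = B `&` A by apply: triv => //; exists x.
  by move=> y [].
(* Cutting a stable block is trivial: one piece is the whole block, the other is empty. *)
have splitE B : pr_blocks P B -> B `&` A = B \/ B `&` A = set0 /\ B `\` A = B.
  move=> PB; have [BA0|/set0P BA] := eqVneq (B `&` A) set0.
    by right; split=> //; apply/setDidPl.
  by left; apply/setIidPl; exact: stable.
apply/seteqP; split=> [X [X0 [B [PB XE]]]|B PB].
  suff -> : X = B by [].
  have [BA|[BA BD]] := splitE B PB; case: XE => XE; rewrite XE //.
    by case: X0 => x; rewrite XE -BA => -[[_ Ax]] [].
  by case: X0 => x; rewrite XE BA.
split; first exact: ne0.
exists B; split=> //.
by have [BA|[_ BD]] := splitE B PB; [left|right].
Qed.

Theorem theorem1 (AP : Type) (K : kripke AP) (P : PR (state K))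
    (hP : preorder_PR P) :
  simulation K (Rel P) <->
  [/\ (forall B C, pr_blocks P B -> pr_blocks P C -> pr_rel P B C ->
         forall b c : state K, B b -> C c -> label b = label c),
      (forall B C D, pr_blocks P B -> pr_blocks P C -> pr_blocks P D ->
         trans_ex B C -> pr_rel P B D -> trans_ex D (mu P C)) &
      (forall C, pr_blocks P C ->
         split_part (pr_blocks P) (pre (mu P C)) = pr_blocks P)].
Proof.
have [refl trans_rel] := hP; have [_ _ ne0] := pr_part P; split=> [sim|].
  split=> [B C PB PC BC b c Bb Cc|B C D PB PC PD [b [c [Bb Cc bc]]] BD|C PC].
  - by case: (sim b c) => //; rewrite /Rel (block_eq PB Bb) (block_eq PC Cc).
  - have [d Dd] := ne0 D PD.
    have [|_ /(_ c bc) [t [dt ct]]] := sim b d.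
      by rewrite /Rel (block_eq PB Bb) (block_eq PD Dd).
    exists d, t; split=> //; apply/(mu_blockE _ PC).
    by rewrite -(block_eq PC Cc).
  - apply/split_part_id => B PB [b [Bb [t [/(mu_blockE _ PC) Ct bt]]]] b' Bb'.
    (* Reflexivity relates any two states of [B], so [b'] matches the move of [b]; transitivity then
       keeps the new target in [mu P C]. *)
    have [|_ /(_ t bt) [t' [bt' tt']]] := sim b b'.
      by rewrite /Rel (block_eq PB Bb) (block_eq PB Bb'); exact: refl.
    exists t'; split=> //; apply/(mu_blockE _ PC).
    exact: trans_rel tt'.
move=> [lab step stable] s s' ss'.
have [[PB Bs] [PD Ds']] := (block_mem P s, block_mem P s').
split=> [|t st]; first exact: lab ss' _ _ Bs Ds'.
have [PC Ct] := block_mem P t.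
have [|d [u [Dd Cu du]]] := step _ _ _ PB PC PD _ ss'; first by exists s, t.
have /split_part_id/(_ _ PD) sub := stable _ PC.
have [|t' [/(mu_blockE _ PC) tt' st']] := sub _ s' Ds'.
  by exists d; split=> //; exists u.
by exists t'.
Qed.
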